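(* Let $d \leq L$ be positive integers, let $D \geq 1$ be an integer, and let $h, d_h$ be positive integers with $d = h \times d_h$. Let $1 = \sigma_1 \geq \cdots \geq \sigma_d > 0$. For $\mathbf{U} \in \mathbb{R}^{d\times L}$ and $\mathbf{W}_Q, \mathbf{W}_K, \mathbf{W}_V \in \mathbb{R}^{d\times d}$ set $$ \mathbf{Y} = \text{MH-Attention}(\mathbf{U}; \mathbf{W}_Q, \mathbf{W}_K, \mathbf{W}_V, h), \qquad \mathbf{Z} = \mathbf{U} + \mathbf{Y}/\sqrt{D}. $$ The following statements hold. 1. Suppose $\sqrt{D} \geq 2e^2 h$. Let $\mathbf{U} \in \mathbb{R}^{d\times L}$ be any matrix with singular values $\sigma_1,\ldots,\sigma_d$, and let $\mathbf{W}_Q,\mathbf{W}_K,\mathbf{W}_V$ be any matrices such that for every $1 \leq i \leq h$, $\|{\mathbf{W}_Q^{(i)}}^\top \mathbf{W}_K^{(i)}\|_2 \leq \sqrt{d_h}$ and $\|\mathbf{W}_V^{(i)}\|_2 \leq 1$. Then for any $1 \leq k \leq d$, $$ \sigma_k(\mathbf{Z})/\sigma_1(\mathbf{Z}) \leq 2 \min_{1 \leq j \leq k}\left( \sigma_{k-j+1} + \frac{e^2 h}{\sqrt{D}}\,\sigma_{\lfloor (j-1)/h\rfloor + 1} \right). $$ 2. For any such $d, L, D, h$ and any singular values $1 = \sigma_1 \geq \cdots \geq \sigma_d > 0$ (without the assumption $\sqrt D \ge 2e^2h$), there exist an input $\mathbf{U} \in \mathbb{R}^{d\times L}$ with singular values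 $\sigma_1,\ldots,\sigma_d$, and matrices $\mathbf{W}_Q, \mathbf{W}_K, \mathbf{W}_V \in \mathbb{R}^{d \times d}$ with $\|\mathbf{W}_V^{(i)}\|_2 \leq 1$ for all $1\le i\le h$, such that for any $1 \leq k \leq d$, $$ \sigma_k(\mathbf{Z})/\sigma_1(\mathbf{Z}) \geq \frac{1}{4}\left( \sigma_{(i-1)d_h + \lceil k/i\rceil} + \frac{1}{\sqrt{D}}\,\sigma_{\lceil k/i\rceil} \right) $$ for every $1 \le i \leq h$ such that $\lceil k/i\rceil < d_h$.
   Context: Multi-head attention with $h$ heads, where $d_h = d/h$: partition $\mathbf{W}_Q,\mathbf{W}_K,\mathbf{W}_V\in\mathbb{R}^{d\times d}$ by rows into $h$ consecutive blocks $\mathbf{W}_{Q}^{(i)},\mathbf{W}_{K}^{(i)},\mathbf{W}_{V}^{(i)} \in \mathbb{R}^{d_h\times d}$, $1 \le i\le h$. For $\mathbf{U}\in\mathbb{R}^{d\times L}$, $\text{MH-Attention}(\mathbf{U}; \mathbf{W}_Q, \mathbf{W}_K, \mathbf{W}_V, h) \in \mathbb{R}^{d\times L}$ is the vertical concatenation over $i = 1,\ldots,h$ of $$ \mathbf{W}_V^{(i)}\mathbf{U}\,\operatorname{softmax}\!\left(\frac{\mathbf{U}^\top {\mathbf{W}_Q^{(i)}}^\top \mathbf{W}_K^{(i)}\mathbf{U}}{\sqrt{d_h}}\right) \in \mathbb{R}^{d_h\times L}, $$ where softmax is applied to each column: $\operatorname{softmax}(\mathbf{T})_{t,j} = e^{\mathbf{T}_{t,j}}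 / \sum_{k=1}^L e^{\mathbf{T}_{k,j}}$. $\sigma_k(\cdot)$ denotes the $k$-th largest singular value and $\|\cdot\|_2$ the spectral norm. *)

(* Defs.v *)
From HB Require Import structures.
From mathcomp Require Import all_boot all_order all_algebra.
From mathcomp Require Import polyrcf.
From mathcomp Require Import all_classical all_reals all_analysis.

Set Implicit Arguments.
Unset Strict Implicit.
Unset Printing Implicit Defensive.

Import Order.TTheory GRing.Theory Num.Theory.

Local Open Scope ring_scope.

Section SingularValues.
Variable R : realType.

(* Real eigenvalues, repeated according to algebraic multiplicity, in
   decreasing order; for a symmetric matrix these are all the eigenvalues. *)
Definition eigenvalues n (A : 'M[R]_n) : seq R :=
  let p := char_poly A in
  sort >=%R (flatten [seq nseq (mup x p) x | x <- rootsR p]).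

(* The index k is 1-based.  An m x n matrix has minn m n singular values;
   beyond that index the value is 0. *)
Definition singular_value m n (A : 'M[R]_(m, n)) (k : nat) : R :=
  Num.sqrt (eigenvalues (A^T *m A))`_k.-1.

(* The norm `|x| of the library on matrices is the sup norm. *)
Definition norm2 n (x : 'cV[R]_n) : R := Num.sqrt (\sum_i x i 0 ^+ 2).

Definition spectral_norm m n (A : 'M[R]_(m, n)) : R :=
  sup [set norm2 (A *m x) | x in [set x : 'cV[R]_n | norm2 x <= 1]]%classic.

End SingularValues.

Section Blocks.
Variables h dh : nat.

Fact block_index_proof (i : 'I_h) (r : 'I_dh) : (i * dh + r < h * dh)%N.
Proof.
by rewrite (@leq_trans (i.+1 * dh)) ?leq_mul2r ?ltn_ord ?orbT // mulSn addnC
           ltn_add2r.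
Qed.

Definition block_index (i : 'I_h) (r : 'I_dh) : 'I_(h * dh) :=
  Ordinal (block_index_proof i r).

Fact block_of_proof (a : 'I_(h * dh)) : (a %/ dh < h)%N.
Proof.
case: (posnP dh) => [dh0|dh_gt0]; last by rewrite ltn_divLR.
by case: a => a; rewrite dh0 muln0.
Qed.

Definition block_of (a : 'I_(h * dh)) : 'I_h := Ordinal (block_of_proof a).

Fact offset_of_proof (a : 'I_(h * dh)) : (a %% dh < dh)%N.
Proof.
by rewrite ltn_mod; case: dh a => [|//] [a]; rewrite muln0.
Qed.

Definition offset_of (a : 'I_(h * dh)) : 'I_dh := Ordinal (offset_of_proof a).

Definition row_block (R : Type) n (W : 'M[R]_(h * dh, n)) (i : 'I_h) :
  'M[R]_(dh, n) := \matrix_(r, c) W (block_index i r) c.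

Definition vconcat (R : Type) n (B : 'I_h -> 'M[R]_(dh, n)) :
  'M[R]_(h * dh, n) := \matrix_(a, c) B (block_of a) (offset_of a) c.

End Blocks.

Section Attention.
Variable R : realType.

Definition softmax m n (T : 'M[R]_(m, n)) : 'M[R]_(m, n) :=
  \matrix_(t, j) (expR (T t j) / \sum_(k < m) expR (T k j)).

Definition mh_attention h dh L (U : 'M[R]_(h * dh, L))
    (WQ WK WV : 'M[R]_(h * dh)) : 'M[R]_(h * dh, L) :=
  vconcat (fun i : 'I_h =>
    row_block WV i *m U *m
    softmax ((Num.sqrt dh%:R)^-1 *:
             (U^T *m (row_block WQ i)^T *m row_block WK i *m U))).

(* U + Y / sqrt D, where Y is the multi-head attention of U. *)
Definition residual_attention (D : nat) h dh L (U : 'M[R]_(h * dh, L))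
    (WQ WK WV : 'M[R]_(h * dh)) : 'M[R]_(h * dh, L) :=
  U + (Num.sqrt D%:R)^-1 *: mh_attention U WQ WK WV.

End Attention.

(* The ceiling of k / i, for i > 0. *)
Definition ceil_div (k i : nat) : nat := (k + i.-1) %/ i.

(* Main.v *)
(* Everything rests on the min-max description of singular values, obtained
   from the real spectral theorem for A^T A: A satisfies |A x| <= s_k |x| on the
   kernel of some k - 1 linear forms, and any bound valid on the kernel of fewer
   than k linear forms dominates s_k.

   Upper bound.  When the logits are at most 1 in absolute value, every softmax
   weight is at most e^2 / L, so each softmax matrix has Frobenius norm at most
   e^2.  Pulling the p = (j - 1) / h linear forms controlling U back through
   each of the h heads and adding the k - j forms for the residual branch gives
   at most k - 1 forms controlling Z; finally s_1(Z) >= 1 - e^2 h / sqrt D.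

   Lower bound.  Take U = [diag sigma | 0] and let head i send, with a large
   logit, the columns of its own block to the first dh - 1 tokens and all other
   columns to the dh-th token, which the value matrix erases.  Up to a leak that
   is arbitrarily small on the first d columns, Z is then diagonal with entries
   sigma_((i-1) dh + r) + sigma_r / sqrt D for r < dh. *)

Require Import Defs.
From HB Require Import structures.
From mathcomp Require Import all_boot all_order all_algebra fingroup perm.
From mathcomp Require Import spectral complex polyrcf.
From mathcomp Require Import all_classical all_reals all_analysis.
From mathcomp Require Import ring lra zify.

Set Implicit Arguments.
Unset Strict Implicit.
Unset Printing Implicit Defensive.

Import Order.TTheory GRing.Theory Num.Theory.

Local Open Scope ring_scope.

(** * Real spectral theorem *)

(** Over the complex numbers [A] becomes hermitian, hence unitarily diagonalisable with real
    diagonal. A diagonal entry is a root of the characteristic polynomial, and this descends to [R]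
    because the embedding is injective. *)
Lemma symmetric_eigenvalue (R : rcfType) n (A : 'M[R]_n.+1) :
  A^T = A -> exists a : R, eigenvalue A a.
Proof.
move=> symA; pose Ac := map_mx (real_complex R) A.
have hermA : Ac \is hermsymmx.
  apply: realsym_hermsym.
    apply/is_hermitianmxP; rewrite expr0 scale1r map_mx_id //.
    by apply/matrixP => i j; rewrite !mxE -{1}symA mxE.
  by apply/mxOverP => i j; rewrite mxE; apply/complex_realP; exists (A i j).
have /orthomx_spectralP := hermitian_normalmx hermA.
(* Multiplying the decomposition by the unitary factor exhibits its rows as left eigenvectors. *)
move=> /(congr1 (mulmx (spectralmx Ac))).
rewrite !mulmxA mulmxV ?spectral_unit // mul1mx => eqPA.
have /mxOverP/(_ 0 0)/complex_realP[a spec0] :=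
  hermitian_spectral_diag_real hermA.
exists a; rewrite eigenvalue_root_char -(fmorph_root (real_complex R)).
rewrite map_char_poly -eigenvalue_root_char; apply/eigenvalueP.
exists (row 0 (spectralmx Ac)).
  by rewrite -row_mul -/Ac eqPA row_mul row_diag_mx -scalemxAl -rowE spec0.
(* An invertible matrix has no zero row. *)
apply/eqP => row0; have /row_freeP[B /(congr1 (row 0))] :
  row_free (spectralmx Ac) by rewrite row_free_unit spectral_unit.
rewrite row_mul row0 mul0mx => /rowP/(_ 0); rewrite !mxE eqxx => /eqP.
by rewrite eq_sym oner_eq0.
Qed.

(** The reflection along [w = u - e] exchanges the unit vectors [u] and [e]. *)
Lemma householder (R : rcfType) n (u : 'cV[R]_n.+1) :
  u^T *m u = 1%:M ->
  exists H : 'M[R]_n.+1, [/\ H^T = H, H *m H = 1%:M & H *m u = delta_mx 0 0].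
Proof.
move=> u_unit; pose e : 'cV[R]_n.+1 := delta_mx 0 0; pose w := u - e.
pose c := (w^T *m w) 0 0; pose t := 2 / c.
have wwE : w^T *m w = c%:M by rewrite [LHS]mx11_scalar.
(* This form of [t * c = 2] survives the case [u = e], where [c = 0] and inversion gives [t = 0], so
   that the reflection degenerates to the identity. It is what makes the reflection an
   involution. *)
have ttc : t * t * c = 2 * t.
  rewrite /t; have [->|c_neq0] := eqVneq c 0; first by rewrite invr0 !mulr0.
  by field.
have symH : (1%:M - t *: (w *m w^T))^T = 1%:M - t *: (w *m w^T).
  by rewrite linearB /= linearZ /= trmx_mul trmxK trmx1.
exists (1%:M - t *: (w *m w^T)); split => //.
  have WW : (w *m w^T) *m (w *m w^T) = c *: (w *m w^T).
    by rewrite mulmxA -(mulmxA w) wwE mul_mx_scalar -scalemxAl.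
  rewrite mulmxBl mul1mx mulmxBr mulmx1 -scalemxAl -scalemxAr WW !scalerA ttc.
  by rewrite mulr_natl mulr2n scalerDl opprB addrK subrK.
have eu : e^T *m u = (u 0 0)%:M.
  rewrite [LHS]mx11_scalar; congr _%:M; rewrite mxE (bigD1 0) //= big1 => [|i].
    by rewrite !mxE eqxx mul1r addr0.
  by move=> /negPf i0; rewrite !mxE i0 mul0r.
have wu : w^T *m u = (1 - u 0 0)%:M.
  by rewrite linearB /= mulmxBl u_unit eu -raddfB.
(* For unit vectors the squared distance is twice one minus the inner product; hence
   [t * (1 - u 0 0) = 1] when [c] is nonzero, and [u] is moved by exactly [- w]. *)
have cE : c = 2 * (1 - u 0 0).
  have ue : u^T *m e = (u 0 0)%:M.
    by rewrite -[u^T *m e]trmxK trmx_mul trmxK eu tr_scalar_mx.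
  have ee : e^T *m e = 1%:M.
    by rewrite trmx_delta mul_delta_mx [LHS]mx11_scalar mxE eqxx.
  suff -> : c = ((2 * (1 - u 0 0))%:M : 'M[R]_1) 0 0 by rewrite mxE eqxx.
  rewrite /c /w mulmxBr linearB /= !mulmxBl u_unit eu ue ee -!raddfB /=.
  by congr (_ _ 0 0); congr (_%:M); ring.
rewrite mulmxBl mul1mx -scalemxAl -mulmxA wu -mul_scalar_mx.
suff -> : w *m (1 - u 0 0)%:M = ((1 - u 0 0) *: w).
  rewrite mul_scalar_mx scalerA.
  have [c0|c_neq0] := eqVneq c 0.
    have w0 : w = 0.
      apply/matrixP => i j; rewrite ord1 [RHS]mxE.
      move: c0; rewrite /c mxE => /eqP.
      rewrite psumr_eq0 => [/allP/(_ i)|k _].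
        by rewrite mem_index_enum !mxE -expr2 sqrf_eq0 => /(_ isT)/eqP.
      by rewrite !mxE -expr2 sqr_ge0.
    by rewrite w0 scaler0 subr0 -(subrK e u) -/w w0 add0r.
  have -> : t * (1 - u 0 0) = 1.
    by apply: (mulIf c_neq0); rewrite mulrAC /t divfK // cE mul1r.
  by rewrite scale1r /w subKr.
by rewrite mul_mx_scalar.
Qed.

(** Deflation: a Householder reflection carries a unit eigenvector to the first basis vector. The
    conjugate [B] then has a diagonal first column, hence by symmetry a diagonal first row, and the
    induction hypothesis applies to its lower right block. *)
Lemma symmetric_spectral (R : rcfType) n (A : 'M[R]_n) :
  A^T = A -> exists (P : 'M[R]_n) (d : 'rV[R]_n),
    P *m P^T = 1%:M /\ A = P^T *m diag_mx d *m P.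
Proof.
elim: n => [|n IHn] in A * => symA.
  by exists 1%:M, 0; split; apply/matrixP => -[].
have [a /eigenvalueP[v vA v_neq0]] := symmetric_eigenvalue symA.
pose s := \sum_i v 0 i ^+ 2.
have s_gt0 : 0 < s.
  rewrite lt0r sumr_ge0 => [|i _]; last exact: sqr_ge0.
  rewrite andbT; apply: contraNneq v_neq0 => s0; apply/eqP/rowP => i.
  move/eqP: s0; rewrite psumr_eq0 => [/allP/(_ i)|k _]; last exact: sqr_ge0.
  by rewrite mem_index_enum sqrf_eq0 mxE => /(_ isT)/eqP.
pose u := (Num.sqrt s)^-1 *: v^T.
have u_unit : u^T *m u = 1%:M.
  have -> : u^T = (Num.sqrt s)^-1 *: v by rewrite linearZ /= trmxK.
  rewrite -scalemxAl -scalemxAr scalerA [v *m _]mx11_scalar.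
  have -> : (v *m v^T) 0 0 = s.
    by rewrite mxE; apply: eq_bigr => i _; rewrite mxE.
  rewrite -invfM -expr2 sqr_sqrtr ?(ltW s_gt0) //.
  by rewrite scale_scalar_mx mulVf ?gt_eqF.
have [H [symH HH Hu]] := householder u_unit.
have Au : A *m u = a *: u.
  rewrite -scalemxAr -[A *m _]trmxK trmx_mul trmxK symA vA.
  by rewrite linearZ /= !scalerA mulrC.
pose B : 'M[R]_(1 + n) := H *m A *m H.
have symB : B^T = B by rewrite /B !trmx_mul symH symA mulmxA.
have Be : B *m delta_mx 0 0 = a *: (delta_mx 0 0 : 'cV_(1 + n)).
  by rewrite -Hu /B -!mulmxA (mulmxA H H) HH mul1mx Au -scalemxAr Hu.
have B0 i : B i 0 = a * (i == 0)%:R.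
  by move/matrixP/(_ i 0): Be; rewrite -colE !mxE eqxx andbT.
have AE : A = H *m B *m H.
  by rewrite /B !mulmxA HH mul1mx -mulmxA HH mulmx1.
clearbody B.
have l0 : lshift n (0 : 'I_1) = 0 :> 'I_(1 + n) by apply/val_inj.
have BE : B = block_mx a%:M 0 0 (drsubmx B).
  rewrite -{1}[B]submxK; congr block_mx.
  - by apply/matrixP => i j; rewrite !ord1 !mxE l0 B0 eqxx mulr1.
  - apply/matrixP => i j; rewrite ord1 -symB 3!mxE l0 B0.
    by rewrite (_ : _ == 0 = false) ?mulr0 ?mxE.
  - by apply/matrixP => i j; rewrite !ord1 !mxE l0 B0 mulr0.
have /IHn[P [d [PP PdP]]] : (drsubmx B)^T = drsubmx B.
  by rewrite trmx_drsub symB.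
pose Q : 'M[R]_(1 + n) := block_mx 1%:M 0 0 P.
pose D : 'rV[R]_(1 + n) := row_mx a%:M d.
have QQ : Q *m Q^T = 1%:M.
  rewrite tr_block_mx trmx1 !trmx0 mulmx_block.
  by rewrite !mulmx1 !mulmx0 !mul0mx !addr0 add0r PP -scalar_mx_block.
have QDQ : B = Q^T *m diag_mx D *m Q.
  rewrite BE tr_block_mx trmx1 !trmx0 diag_mx_row.
  rewrite !mulmx_block !mulmx1 !mul1mx !mulmx0 !mul0mx !addr0 !add0r.
  rewrite PdP; congr block_mx; last by rewrite mul0mx.
  by apply/matrixP => i j; rewrite !ord1 !mxE eqxx.
exists (Q *m H), D; split.
  by rewrite trmx_mul symH -mulmxA (mulmxA H) HH mul1mx.
by rewrite AE QDQ trmx_mul symH !mulmxA.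
Qed.

(** Occurrences are counted: [x] comes only from its own block, whose length is the multiplicity of
    the root [x], that is, the number of times [x] occurs in [s]. *)
Lemma perm_rootsR_mup (R : rcfType) (s : seq R) :
  perm_eq (flatten [seq nseq (mup x (\prod_(y <- s) ('X - y%:P))) x
                   | x <- rootsR (\prod_(y <- s) ('X - y%:P))]) s.
Proof.
set p := \prod_(y <- s) _.
have p_neq0 : p != 0 by rewrite monic_neq0 ?monic_prod_XsubC.
have mem_rootsR y : (y \in rootsR p) = (y \in s).
  by rewrite -(roots_on_rootsR p_neq0) inE /= root_prod_XsubC.
apply/allP => x _ /=; apply/eqP.
rewrite count_flatten -map_comp.
rewrite (eq_map (g := fun y => if y == x then count_mem x s else 0%N));
  last first.
  move=> y /=; rewrite count_nseq /= mu_prod_XsubC.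
  by case: eqVneq => [->|_]; rewrite ?mul1n ?mul0n.
have [x_s|x_s] := boolP (x \in s); last first.
  by rewrite (count_memPn x_s) sumnE big_map big1 // => y _; case: ifP.
rewrite sumnE big_map -big_mkcond big_const_seq iter_addn_0.
have u : uniq (rootsR p) by exact: uniq_roots.
by rewrite (count_uniq_mem x u) mem_rootsR x_s muln1.
Qed.

(** Similar matrices share their characteristic polynomial. The determinant of [P^T] is cancelled
    from the intertwining relation between ['X - A] and ['X - diag_mx d]. *)
Lemma eigenvalues_diag (R : realType) n (P A : 'M[R]_n) (d : 'rV_n) :
  P *m P^T = 1%:M -> A = P^T *m diag_mx d *m P ->
  perm_eq (eigenvalues A) (codom (d 0)).
Proof.
move=> PP AE; rewrite /eigenvalues perm_sort.
have -> : char_poly A = \prod_(x <- codom (d 0)) ('X - x%:P).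
  have PA : A *m P^T = P^T *m diag_mx d by rewrite AE -!mulmxA PP mulmx1.
  have Pu : P^T \in unitmx by case/mulmx1_unit: PP.
  transitivity (char_poly (diag_mx d)).
    rewrite /char_poly /char_poly_mx.
    set f := map_mx _.
    have /(congr1 determinant) :
        ('X%:M - f A) *m f P^T = f P^T *m ('X%:M - f (diag_mx d)).
      by rewrite mulmxBl mulmxBr -!map_mxM PA scalar_mxC.
    rewrite !det_mulmx mulrC; apply: mulfI.
    by rewrite det_map_mx polyC_eq0 -unitfE -unitmxE.
  rewrite char_poly_trig ?diag_mx_is_trig // big_image /=.
  by apply: eq_bigr => i _; rewrite mxE eqxx.
exact: perm_rootsR_mup.
Qed.

Lemma eigenvalues_sorted (R : realType) n (A : 'M[R]_n) :
  sorted >=%R (eigenvalues A).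
Proof. by apply: sort_sorted => x y; apply: ge_total. Qed.

(** Permuting the rows of the orthogonal factor puts any diagonalisation in the sorted order used by
    [eigenvalues]. *)
Lemma symmetric_spectral_sorted (R : realType) n (A : 'M[R]_n) :
  A^T = A -> exists P : 'M[R]_n,
    P *m P^T = 1%:M /\
    A = P^T *m diag_mx (\row_i (eigenvalues A)`_i) *m P.
Proof.
move=> /symmetric_spectral[P [d [PP AE]]].
have := eigenvalues_diag PP AE.
have -> : codom (d 0) = [tuple d 0 i | i < n] by [].
move=> /tuple_permP[s eig].
have {}eig (i : 'I_n) : (eigenvalues A)`_i = d 0 (s i).
  by rewrite eig nth_mktuple tnth_mktuple.
exists (row_perm s P); split.
  rewrite row_permE trmx_mul mulmxA -(mulmxA _ P) PP mulmx1.
  by rewrite tr_perm_mx -perm_mxM mulgV perm_mx1.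
apply/matrixP => i j; rewrite [in LHS]AE !mul_mx_diag !mxE.
rewrite (reindex_inj (@perm_inj _ s)) /=.
by apply: eq_bigr => k _; rewrite !mxE eig.
Qed.

(** * Euclidean norm and min-max principle *)

(** The sum of the squares of [q * a i - r * b i] equals [q * (p * q - r ^+ 2)]. Dividing by [q] is
    possible unless [b] vanishes. *)
Lemma sum_cauchy_schwarz (R : realFieldType) (I : finType) (a b : I -> R) :
  (\sum_i a i * b i) ^+ 2 <= (\sum_i a i ^+ 2) * (\sum_i b i ^+ 2).
Proof.
set r := \sum_i a i * b i; set p := \sum_i a i ^+ 2; set q := \sum_i b i ^+ 2.
have q_ge0 : 0 <= q by apply: sumr_ge0 => i _; apply: sqr_ge0.
have : 0 <= \sum_i (q * a i - r * b i) ^+ 2.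
  by apply: sumr_ge0 => i _; apply: sqr_ge0.
have sumE u v : \sum_i (u * a i - v * b i) ^+ 2 =
    u ^+ 2 * (\sum_i a i ^+ 2) - 2 * u * v * (\sum_i a i * b i)
    + v ^+ 2 * (\sum_i b i ^+ 2).
  rewrite !mulr_sumr -sumrB -big_split /=.
  by apply: eq_bigr => i _; ring.
have -> : \sum_i (q * a i - r * b i) ^+ 2 = q * (p * q - r ^+ 2).
  by rewrite sumE -/p -/q -/r; ring.
have [q0 _|q_neq0] := eqVneq q 0; last first.
  by rewrite pmulr_rge0 ?subr_ge0 // lt0r q_neq0.
have b0 i : b i = 0.
  move/eqP: q0; rewrite psumr_eq0 => [/allP/(_ i)|j _]; last exact: sqr_ge0.
  by rewrite mem_index_enum sqrf_eq0 => /(_ isT)/eqP.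
rewrite /r big1 ?q0 ?expr0n ?mulr0 // => i _.
by rewrite b0 mulr0.
Qed.

Section Norm2.
Variable R : realType.
Implicit Types m n : nat.

Lemma norm2_ge0 n (x : 'cV[R]_n) : 0 <= norm2 x.
Proof. exact: sqrtr_ge0. Qed.

Lemma sqr_norm2 n (x : 'cV[R]_n) : norm2 x ^+ 2 = \sum_i x i 0 ^+ 2.
Proof. by rewrite sqr_sqrtr // sumr_ge0 // => i _; apply: sqr_ge0. Qed.

Lemma norm2_dot n (x : 'cV[R]_n) : x^T *m x = (norm2 x ^+ 2)%:M.
Proof.
rewrite [LHS]mx11_scalar sqr_norm2; congr _%:M.
by rewrite mxE; apply: eq_bigr => i _; rewrite mxE.
Qed.

Lemma eq_norm2 m n (x : 'cV[R]_m) (y : 'cV[R]_n) :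
  x^T *m x = y^T *m y -> norm2 x = norm2 y.
Proof.
rewrite !norm2_dot => /matrixP/(_ 0 0); rewrite !mxE => /eqP.
by rewrite eqrXn2 ?norm2_ge0 // => /eqP.
Qed.

Lemma norm2_le n (x : 'cV[R]_n) c :
  0 <= c -> \sum_i x i 0 ^+ 2 <= c ^+ 2 -> norm2 x <= c.
Proof. by move=> c_ge0; rewrite -sqr_norm2 ler_sqr ?nnegrE ?norm2_ge0. Qed.

Lemma norm20 n : norm2 (0 : 'cV[R]_n) = 0.
Proof. by rewrite /norm2 big1 ?sqrtr0 // => i _; rewrite mxE expr0n. Qed.

Lemma norm2_gt0 n (x : 'cV[R]_n) : x != 0 -> 0 < norm2 x.
Proof.
move=> x_neq0; rewrite lt0r norm2_ge0 andbT; apply: contra x_neq0.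
rewrite -sqrf_eq0 sqr_norm2 psumr_eq0 => [/allP x0|i _]; last exact: sqr_ge0.
apply/eqP/colP => i; rewrite mxE; apply/eqP; rewrite -sqrf_eq0.
by apply: x0; rewrite mem_index_enum.
Qed.

Lemma norm2Z n a (x : 'cV[R]_n) : norm2 (a *: x) = `|a| * norm2 x.
Proof.
apply/eqP; rewrite -(@eqrXn2 _ 2) ?mulr_ge0 ?norm2_ge0 // exprMn.
rewrite real_normK ?num_real //.
rewrite !sqr_norm2 big_distrr /=; apply/eqP; apply: eq_bigr => i _.
by rewrite mxE exprMn.
Qed.

Lemma norm2_dot_le n (x y : 'cV[R]_n) : `|(x^T *m y) 0 0| <= norm2 x * norm2 y.
Proof.
rewrite -ler_sqr ?nnegrE ?mulr_ge0 ?norm2_ge0 // real_normK ?num_real //.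
rewrite exprMn !sqr_norm2 mxE.
under eq_bigr do rewrite mxE; exact: sum_cauchy_schwarz.
Qed.

Lemma norm2D n (x y : 'cV[R]_n) : norm2 (x + y) <= norm2 x + norm2 y.
Proof.
rewrite -ler_sqr ?nnegrE ?addr_ge0 ?norm2_ge0 // sqrrD !sqr_norm2.
under eq_bigr do rewrite mxE sqrrD.
rewrite !big_split /= lerD2r lerD2l -mulr2n lerMn2r /=.
apply: le_trans (norm2_dot_le x y); apply: le_trans (ler_norm _).
by rewrite mxE ler_sum // => i _; rewrite mxE.
Qed.

(** The Frobenius norm dominates the operator norm, by Cauchy-Schwarz in each row. *)
Lemma norm2_mulmx_le m n (A : 'M[R]_(m, n)) (x : 'cV[R]_n) c :
  0 <= c -> \sum_i \sum_j A i j ^+ 2 <= c ^+ 2 ->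
  norm2 (A *m x) <= c * norm2 x.
Proof.
move=> c_ge0 Ac; apply: norm2_le; first by rewrite mulr_ge0 ?norm2_ge0.
rewrite exprMn; apply: le_trans (ler_wpM2r (sqr_ge0 _) Ac).
rewrite sqr_norm2 big_distrl /=; apply: ler_sum => i _.
by rewrite mxE sum_cauchy_schwarz.
Qed.

Lemma norm2_mulmx_bound m n (A : 'M[R]_(m, n)) :
  exists2 c, 0 <= c & forall x : 'cV[R]_n, norm2 (A *m x) <= c * norm2 x.
Proof.
exists (Num.sqrt (\sum_i \sum_j A i j ^+ 2)); first exact: sqrtr_ge0.
move=> x; apply: norm2_mulmx_le; rewrite ?sqrtr_ge0 // sqr_sqrtr //.
by apply: sumr_ge0 => i _; apply: sumr_ge0 => j _; apply: sqr_ge0.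
Qed.

(** The supremum is over a set bounded by the Frobenius estimate, so it dominates the value at the
    normalised vector. *)
Lemma spectral_normP m n (A : 'M[R]_(m, n)) (x : 'cV[R]_n) :
  norm2 (A *m x) <= spectral_norm A * norm2 x.
Proof.
have [->|x_neq0] := eqVneq x 0; first by rewrite mulmx0 !norm20 mulr0.
have x_gt0 := norm2_gt0 x_neq0.
rewrite -ler_pdivrMr //; apply: ub_le_sup.
  have [c c_ge0 Ac] := norm2_mulmx_bound A.
  exists c => _ [y /= y_le1 <-]; apply: le_trans (Ac y) _.
  by rewrite ler_piMr.
exists ((norm2 x)^-1 *: x) => /=.
  by rewrite norm2Z normfV ger0_norm ?norm2_ge0 // mulVf ?gt_eqF.
by rewrite -scalemxAr norm2Z normfV ger0_norm ?norm2_ge0 // mulrC.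
Qed.

Lemma spectral_norm_le m n (A : 'M[R]_(m, n)) c :
  0 <= c -> (forall x : 'cV[R]_n, norm2 (A *m x) <= c * norm2 x) ->
  spectral_norm A <= c.
Proof.
move=> c_ge0 Ac; apply: ge_sup.
  by exists (norm2 (A *m 0)), 0 => //=; rewrite norm20.
move=> _ [x /= x_le1 <-]; apply: le_trans (Ac x) _.
by rewrite ler_piMr.
Qed.

End Norm2.

(** Dimension count: stacking [B] on the rows of [Q] indexed by [J] gives fewer than [n] linear
    forms, which have a common nonzero zero. *)
Lemma mulmx_kernel_vector (F : fieldType) p n q (B : 'M[F]_(p, n))
    (Q : 'M[F]_(q, n)) (J : {set 'I_q}) :
  (p + #|J| < n)%N ->
  exists x : 'cV[F]_n,
    [/\ x != 0, B *m x = 0 & forall i, i \in J -> (Q *m x) i 0 = 0].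
Proof.
move=> lt_n; pose M := col_mx B (rowsub (enum_val (A := J)) Q).
have : kermx M^T != 0.
  rewrite kermx_eq0 /row_free; apply: contraTneq lt_n => rkM.
  by rewrite -leqNgt -rkM rank_leq_col.
case/rowV0Pn => v /sub_kermxP vM v_neq0.
have Mv : M *m v^T = 0 by rewrite -[M]trmxK -trmx_mul vM trmx0.
have /eq_col_mx[Bv Qv] : col_mx (B *m v^T) (rowsub (enum_val (A := J)) Q *m v^T)
    = col_mx 0 0 by rewrite -mul_col_mx col_mx0.
exists v^T; split=> // [|i iJ].
  by apply: contraNneq v_neq0 => v0; rewrite -[v]trmxK v0 trmx0.
rewrite -(enum_rankK_in iJ iJ).
by move/colP/(_ (enum_rank_in iJ i)): Qv; rewrite mul_rowsub_mx !mxE.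
Qed.

Lemma card_ord_lt n k : (k <= n)%N -> #|[set i : 'I_n | (i < k)%N]| = k.
Proof.
move=> le_kn; rewrite -sum1_card (eq_bigl (fun i : 'I_n => (i < k)%N)).
  by rewrite -(big_ord_widen n (fun=> 1%N) le_kn) sum1_card card_ord.
by move=> i; rewrite inE.
Qed.

(** * Min-max bounds through kernels of linear forms *)

Section MinMax.
Variables (R : realType) (m n : nat) (A : 'M[R]_(m, n)).

Let lambda (i : nat) : R := (eigenvalues (A^T *m A))`_i.

(** In the eigenbasis of [A^T *m A] both squared norms are diagonal quadratic forms, so comparing
    them reduces to comparing coefficients. *)
Lemma gram_spectral : exists P : 'M[R]_n,
  [/\ P *m P^T = 1%:M,
      forall x : 'cV_n, norm2 x ^+ 2 = \sum_i (P *m x) i 0 ^+ 2 &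
      forall x : 'cV_n,
        norm2 (A *m x) ^+ 2 = \sum_(i < n) lambda i * (P *m x) i 0 ^+ 2].
Proof.
have symG : (A^T *m A)^T = A^T *m A by rewrite trmx_mul trmxK.
have [P [PP GE]] := symmetric_spectral_sorted symG.
exists P; split=> // x.
  rewrite -sqr_norm2; congr (_ ^+ 2); apply: eq_norm2.
  by rewrite trmx_mul -mulmxA (mulmxA P^T) (mulmx1C PP) mul1mx.
have := norm2_dot (A *m x); rewrite trmx_mul -mulmxA (mulmxA A^T) GE.
rewrite -!mulmxA mulmxA -trmx_mul => /matrixP/(_ 0 0).
rewrite [RHS]mxE eqxx mulr1n => <-; rewrite mxE; apply: eq_bigr => i _.
by rewrite mul_diag_mx !mxE mulrCA expr2.
Qed.

Lemma gram_eigenvalue_ge0 (i : 'I_n) : 0 <= lambda i.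
Proof.
have [P [PP _ AE]] := gram_spectral.
(* At the [i]-th eigenvector the quadratic form takes the value [lambda i], which is therefore a
   square. *)
have := AE (P^T *m delta_mx i 0); rewrite (mulmxA P) PP mul1mx (bigD1 i) //=.
rewrite big1 => [|j /negPf ji]; last by rewrite mxE ji expr0n mulr0.
by rewrite mxE !eqxx expr1n mulr1 addr0 => <-; apply: sqr_ge0.
Qed.

Lemma gram_eigenvalue_anti (i j : 'I_n) : (i <= j)%N -> lambda j <= lambda i.
Proof.
move=> le_ij.
have symG : (A^T *m A)^T = A^T *m A by rewrite trmx_mul trmxK.
(* The list has full length, so no index below [n] falls on the default value [0]. *)
have sz : size (eigenvalues (A^T *m A)) = n.
  have [P [d [PP GE]]] := symmetric_spectral symG.
  by rewrite (perm_size (eigenvalues_diag PP GE)) size_codom card_ord.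
have ge_tr : transitive (>=%R : rel R) by move=> x y z /[swap]; apply: le_trans.
apply: (sorted_leq_nth ge_tr (@ge_refl _ _) 0 (eigenvalues_sorted _));
  by rewrite ?inE ?sz.
Qed.

Lemma sqr_singular_value (i : 'I_n) : singular_value A i.+1 ^+ 2 = lambda i.
Proof. by rewrite sqr_sqrtr //= gram_eigenvalue_ge0. Qed.

Lemma singular_value_ge0 k : 0 <= singular_value A k.
Proof. exact: sqrtr_ge0. Qed.

Lemma singular_value_anti k l :
  (0 < k <= l)%N -> (l <= n)%N -> singular_value A l <= singular_value A k.
Proof.
case: k l => // k [|l] //=; rewrite ltnS => le_kl lt_ln; apply: ler_wsqrtr.
have lt_kn : (k < n)%N := leq_ltn_trans le_kl lt_ln.
exact: (@gram_eigenvalue_anti (Ordinal lt_kn) (Ordinal lt_ln) le_kl).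
Qed.

(** The forms are the first [k.-1] eigencoordinates; on their kernel only eigenvalues from the
    [k]-th on contribute. *)
Lemma singular_value_kernel k : (0 < k <= n)%N ->
  exists B : 'M[R]_(k.-1, n), forall x : 'cV_n, B *m x = 0 ->
    norm2 (A *m x) <= singular_value A k * norm2 x.
Proof.
case: k => //= k lt_kn; have [P [PP xE AE]] := gram_spectral.
exists (rowsub (widen_ord (ltnW lt_kn)) P) => x.
rewrite mul_rowsub_mx => Px0.
have {}Px0 (i : 'I_n) : (i < k)%N -> (P *m x) i 0 = 0.
  move=> lt_ik; move/colP/(_ (Ordinal lt_ik)): Px0; rewrite [RHS]mxE => <-.
  by rewrite [RHS]mxE; congr ((P *m x) _ 0); apply: val_inj.
rewrite -ler_sqr ?nnegrE ?mulr_ge0 ?norm2_ge0 ?singular_value_ge0 // exprMn.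
rewrite (sqr_singular_value (Ordinal lt_kn)) AE xE big_distrr /=.
apply: ler_sum => i _; have [lt_ik|le_ki] := ltnP i k.
  by rewrite Px0 // expr0n !mulr0.
by rewrite ler_wpM2r ?sqr_ge0 // (@gram_eigenvalue_anti (Ordinal lt_kn)).
Qed.

(** The span of the first [k] eigenvectors has dimension larger than [p], so it meets the kernel of
    [B] in a nonzero [x]; there [A] stretches by at least its [k]-th singular value. *)
Lemma singular_value_le k p (B : 'M[R]_(p, n)) c :
  (p < k <= n)%N -> 0 <= c ->
  (forall x : 'cV_n, B *m x = 0 -> norm2 (A *m x) <= c * norm2 x) ->
  singular_value A k <= c.
Proof.
case: k => // k /andP[lt_pk lt_kn] c_ge0 Ac.
have [P [PP xE AE]] := gram_spectral.
have [|x [x_neq0 Bx Px]] :=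
    @mulmx_kernel_vector _ _ _ _ B P (~: [set i : 'I_n | (i < k.+1)%N]).
  rewrite cardsCs finset.setCK card_ord_lt // card_ord.
  by lia.
have x_gt0 := norm2_gt0 x_neq0.
rewrite -(ler_pM2r x_gt0); apply: le_trans (Ac x Bx).
rewrite -ler_sqr ?nnegrE ?mulr_ge0 ?norm2_ge0 ?singular_value_ge0 // exprMn.
rewrite (sqr_singular_value (Ordinal lt_kn)) AE xE big_distrr /=.
apply: ler_sum => i _; have [lt_ik|le_ki] := ltnP i k.+1.
  by rewrite ler_wpM2r ?sqr_ge0 // (@gram_eigenvalue_anti _ (Ordinal lt_kn)).
by rewrite Px ?inE -?leqNgt // expr0n !mulr0.
Qed.

(** The coordinate subspace on [J] has dimension at least [k], so it meets the kernel of the [k.-1]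
    forms given by [singular_value_kernel]. *)
Lemma singular_value_ge k (J : {set 'I_n}) c :
  (0 < k <= #|J|)%N ->
  (forall x : 'cV_n, (forall i, i \notin J -> x i 0 = 0) ->
     c * norm2 x <= norm2 (A *m x)) ->
  c <= singular_value A k.
Proof.
move=> /andP[k_gt0 le_kJ] cA.
have le_Jn : (#|J| <= n)%N by apply: leq_trans (max_card _) _; rewrite card_ord.
have [|B BA] := @singular_value_kernel k.
  by rewrite k_gt0 (leq_trans le_kJ).
have [|x [x_neq0 Bx xJ]] := @mulmx_kernel_vector _ _ _ _ B 1%:M (~: J).
  by rewrite cardsCs finset.setCK card_ord; lia.
rewrite -(ler_pM2r (norm2_gt0 x_neq0)); apply: le_trans (BA x Bx).
by apply: cA => i iJ; rewrite -[x]mul1mx xJ // inE.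
Qed.

End MinMax.

(** * Upper bound *)

Section BlockTheory.
Variables h dh : nat.
Implicit Types (i : 'I_h) (r : 'I_dh).

Lemma block_of_index i r : block_of (block_index i r) = i.
Proof.
apply: val_inj; rewrite /= divnMDl ?(leq_ltn_trans _ (ltn_ord r)) //.
by rewrite divn_small ?addn0.
Qed.

Lemma offset_of_index i r : offset_of (block_index i r) = r.
Proof. by apply: val_inj; rewrite /= modnMDl modn_small. Qed.

Lemma block_indexK (a : 'I_(h * dh)) :
  block_index (block_of a) (offset_of a) = a.
Proof. by apply: val_inj; rewrite /= -divn_eq. Qed.

Lemma sum_block_index (V : nmodType) (F : 'I_(h * dh) -> V) :
  \sum_a F a = \sum_i \sum_r F (block_index i r).
Proof.
rewrite pair_big /= (reindex (fun p : 'I_h * 'I_dh => block_index p.1 p.2)) //.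
exists (fun a => (block_of a, offset_of a)) => [[i r] _|a _] /=.
  by rewrite block_of_index offset_of_index.
exact: block_indexK.
Qed.

Lemma row_block_vconcat (T : Type) n (B : 'I_h -> 'M[T]_(dh, n)) i :
  row_block (vconcat B) i = B i.
Proof.
by apply/matrixP => r c; rewrite !mxE block_of_index offset_of_index.
Qed.

Lemma mul_vconcat (R : pzSemiRingType) m n (B : 'I_h -> 'M[R]_(dh, m))
    (X : 'M[R]_(m, n)) :
  vconcat B *m X = vconcat (fun i => B i *m X).
Proof.
by apply/matrixP => a c; rewrite !mxE; apply: eq_bigr => j _; rewrite mxE.
Qed.

Lemma sqr_norm2_vconcat (R : realType) (x : 'I_h -> 'cV[R]_dh) :
  norm2 (vconcat x) ^+ 2 = \sum_i norm2 (x i) ^+ 2.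
Proof.
rewrite sqr_norm2 sum_block_index; apply: eq_bigr => i _.
rewrite sqr_norm2; apply: eq_bigr => r _.
by rewrite mxE block_of_index offset_of_index.
Qed.

End BlockTheory.

(** * Softmax with bounded logits and attention heads *)

Lemma softmax_bound (R : realType) m n (T : 'M[R]_(m, n)) i j :
  (forall t u, `|T t u| <= 1) ->
  0 <= softmax T i j <= expR 1 ^+ 2 / m%:R.
Proof.
move=> T_le1; have m_gt0 : (0 < m)%N by apply: leq_ltn_trans (ltn_ord i).
have e_gt0 : 0 < expR 1 :> R := expR_gt0 _.
rewrite mxE divr_ge0 ?expR_ge0 ?sumr_ge0 //=.
(* Each of the [m] exponentials is at least [1 / e], while the numerator is at most [e]; this is
   where [e^2 / m] comes from. *)
have sum_ge : m%:R / expR 1 <= \sum_(k < m) expR (T k j).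
  rewrite mulrC mulr_natr -[m in _ *+ m]card_ord -sumr_const -expRN.
  apply: ler_sum => k _; rewrite ler_expR.
  by have := T_le1 k j; rewrite ler_norml => /andP[].
have m_gt0R : 0 < m%:R :> R by rewrite ltr0n.
have den_gt0 := lt_le_trans (divr_gt0 m_gt0R e_gt0) sum_ge.
rewrite ler_pdivrMr //; apply: le_trans (_ : expR 1 <= _).
  by rewrite ler_expR; apply: le_trans (ler_norm _) (T_le1 _ _).
apply: le_trans (ler_wpM2l _ sum_ge); last by rewrite divr_ge0 ?sqr_ge0.
by rewrite expr2 -!mulrA mulKf ?gt_eqF // divff ?gt_eqF // mulr1.
Qed.

(** There are [n * n] entries of size at most [e^2 / n], so the Frobenius norm is at most [e^2],
    whatever [n] is. *)
Lemma softmax_mulmx_le (R : realType) n (T : 'M[R]_n) (x : 'cV[R]_n) :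
  (forall t u, `|T t u| <= 1) ->
  norm2 (softmax T *m x) <= expR 1 ^+ 2 * norm2 x.
Proof.
move=> T_le1; have [n0|n_gt0] := posnP n.
  have -> : softmax T *m x = 0 by apply/matrixP => i; have := ltn_ord i; lia.
  by rewrite norm20 mulr_ge0 ?norm2_ge0 ?sqr_ge0.
apply: norm2_mulmx_le; first exact: sqr_ge0.
apply: le_trans (_ : \sum_(i < n) \sum_(j < n) (expR 1 ^+ 2 / n%:R) ^+ 2 <= _).
  apply: ler_sum => i _; apply: ler_sum => j _.
  have /andP[P_ge0 P_le] := softmax_bound i j T_le1.
  by rewrite ler_sqr ?nnegrE // (le_trans P_ge0).
rewrite !sumr_const card_ord -mulrnA -[_ *+ (n * n)]mulr_natr natrM.
by rewrite expr_div_n -expr2 divfK // sqrf_eq0 pnatr_eq0 -lt0n.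
Qed.

(** A logit is the bilinear form of [M] at two columns of [U], divided by [c]; these columns have
    norm at most [1], and Cauchy-Schwarz applies. *)
Lemma attention_logit_le (R : realType) d n (U : 'M[R]_(d, n)) (M : 'M[R]_d) c :
  0 < c ->
  (forall x : 'cV_n, norm2 (U *m x) <= norm2 x) ->
  (forall x : 'cV_d, norm2 (M *m x) <= c * norm2 x) ->
  forall t u, `|(c^-1 *: (U^T *m M *m U)) t u| <= 1.
Proof.
move=> c_gt0 U_le1 M_lec t u.
have col_le1 j : norm2 (col j U) <= 1.
  rewrite colE; apply: le_trans (U_le1 _) _.
  apply: norm2_le => //; rewrite expr1n (bigD1 j) //= big1 => [|i /negPf ij].
    by rewrite mxE !eqxx expr1n addr0.
  by rewrite mxE ij expr0n.
rewrite mxE normrM normfV (gtr0_norm c_gt0) mulrC ler_pdivrMr // mul1r.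
have -> : (U^T *m M *m U) t u = ((col t U)^T *m (M *m col u U)) 0 0.
  by rewrite tr_col colE !mulmxA -!row_mul -colE [in RHS]mxE [in RHS]mxE.
apply: le_trans (norm2_dot_le _ _) _.
apply: le_trans (ler_pM (norm2_ge0 _) (norm2_ge0 _) (col_le1 t) (M_lec _)) _.
by rewrite mul1r ler_piMr // ltW.
Qed.

Section AttentionKernel.
Variables (R : realType) (h dh L : nat).
Variables (U : 'M[R]_(h * dh, L)) (WQ WK WV : 'M[R]_(h * dh)).
Hypothesis dh_gt0 : (0 < dh)%N.
Hypothesis U_le1 : forall x : 'cV_L, norm2 (U *m x) <= norm2 x.
Hypothesis WQK_le : forall i : 'I_h,
  spectral_norm ((row_block WQ i)^T *m row_block WK i) <= Num.sqrt (dh%:R : R).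
Hypothesis WV_le1 : forall i : 'I_h, spectral_norm (row_block WV i) <= 1.

(** The forms are the rows of all [C *m P i]: on their common kernel every [P i *m x] lies in the
    kernel of [C], where [U] contracts by [c]. Each head is then bounded by [e^2 * c]. *)
Lemma mh_attention_kernel p (C : 'M[R]_(p, L)) c :
  0 <= c -> (forall x : 'cV_L, C *m x = 0 -> norm2 (U *m x) <= c * norm2 x) ->
  exists B : 'M[R]_(h * p, L), forall x : 'cV_L, B *m x = 0 ->
    norm2 (mh_attention U WQ WK WV *m x)
      <= expR 1 ^+ 2 * h%:R * c * norm2 x.
Proof.
move=> c_ge0 UC.
pose P i := softmax ((Num.sqrt dh%:R)^-1 *:
              (U^T *m (row_block WQ i)^T *m row_block WK i *m U)).
have P_le i (x : 'cV_L) : norm2 (P i *m x) <= expR 1 ^+ 2 * norm2 x.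
  apply: softmax_mulmx_le; rewrite -(mulmxA U^T).
  apply: attention_logit_le => // [|y]; first by rewrite sqrtr_gt0 ltr0n.
  apply: le_trans (spectral_normP _ _) _.
  by rewrite ler_wpM2r ?norm2_ge0.
exists (vconcat (fun i => C *m P i)) => x.
rewrite mul_vconcat => CPx0.
have {}CPx0 i : C *m (P i *m x) = 0.
  move/(congr1 (fun X => row_block X i)): CPx0.
  by rewrite row_block_vconcat mulmxA => ->; apply/matrixP => r j; rewrite !mxE.
have head_le i :
    norm2 (row_block WV i *m U *m P i *m x) <= expR 1 ^+ 2 * c * norm2 x.
  rewrite -!mulmxA; apply: le_trans (spectral_normP _ _) _.
  apply: le_trans (ler_wpM2r (norm2_ge0 _) (WV_le1 i)) _; rewrite mul1r.
  apply: le_trans (UC _ (CPx0 i)) _.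
  by rewrite [_ ^+ 2 * c]mulrC -mulrA ler_wpM2l.
rewrite /mh_attention mul_vconcat.
have e2c_ge0 : 0 <= expR 1 ^+ 2 * c * norm2 x.
  by rewrite !mulr_ge0 ?sqr_ge0 ?norm2_ge0.
rewrite -ler_sqr ?nnegrE ?norm2_ge0 ?mulr_ge0 ?sqr_ge0 ?norm2_ge0 //.
rewrite sqr_norm2_vconcat.
have -> : expR 1 ^+ 2 * h%:R * c * norm2 x =
          h%:R * (expR 1 ^+ 2 * c * norm2 x) by ring.
move: (expR 1 ^+ 2 * c * norm2 x) e2c_ge0 head_le => w w_ge0 head_le.
(* Squared norms of the stacked heads add up to at most [h * w ^+ 2], which is relaxed to
   [(h * w) ^+ 2]. *)
apply: le_trans (_ : \sum_(i < h) w ^+ 2 <= _).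
  by apply: ler_sum => i _; rewrite ler_sqr ?nnegrE ?norm2_ge0.
rewrite sumr_const card_ord -[_ *+ h in leLHS]mulr_natl exprMn.
rewrite ler_wpM2r ?sqr_ge0 //.
by rewrite -natrX ler_nat; case: (h) => // n; rewrite expnS expn1 leq_pmulr.
Qed.

End AttentionKernel.

Lemma norm2_mulmx_le_singular_value1 (R : realType) m n (A : 'M[R]_(m, n))
    (x : 'cV_n) :
  (0 < n)%N -> norm2 (A *m x) <= singular_value A 1 * norm2 x.
Proof.
move=> n_gt0; have [|B BA] := @singular_value_kernel _ _ _ A 1.
  by rewrite n_gt0.
by apply: BA; apply/matrixP => -[].
Qed.

(** * Singular values of the residual output *)

Section UpperBound.
Variables (R : realType) (h dh L D : nat).
Variables (U : 'M[R]_(h * dh, L)) (WQ WK WV : 'M[R]_(h * dh)).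
Hypothesis h_gt0 : (0 < h)%N.
Hypothesis dh_gt0 : (0 < dh)%N.
Hypothesis le_dL : (h * dh <= L)%N.
Hypothesis D_large : 2 * expR 1 ^+ 2 * h%:R <= Num.sqrt (D%:R : R).
Hypothesis U_sv1 : singular_value U 1 = 1.
Hypothesis WQK_le : forall i : 'I_h,
  spectral_norm ((row_block WQ i)^T *m row_block WK i) <= Num.sqrt (dh%:R : R).
Hypothesis WV_le1 : forall i : 'I_h, spectral_norm (row_block WV i) <= 1.

Let Z := residual_attention D U WQ WK WV.
Let eta : R := expR 1 ^+ 2 * h%:R / Num.sqrt D%:R.

Let e2h_gt0 : 0 < expR 1 ^+ 2 * h%:R :> R.
Proof. by rewrite mulr_gt0 ?exprn_gt0 ?expR_gt0 ?ltr0n. Qed.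

Let sqrtD_gt0 : 0 < Num.sqrt (D%:R : R).
Proof. by apply: lt_le_trans D_large; rewrite -mulrA mulr_gt0. Qed.

Let eta_ge0 : 0 <= eta. Proof. by rewrite divr_ge0 ?ltW. Qed.

Let L_gt0 : (0 < L)%N.
Proof. by apply: leq_trans le_dL; rewrite muln_gt0 h_gt0. Qed.

Let U_le1 (x : 'cV_L) : norm2 (U *m x) <= norm2 x.
Proof.
by have := norm2_mulmx_le_singular_value1 U x L_gt0; rewrite U_sv1 mul1r.
Qed.

Lemma attention_term_kernel p (C : 'M[R]_(p, L)) c :
  0 <= c -> (forall x : 'cV_L, C *m x = 0 -> norm2 (U *m x) <= c * norm2 x) ->
  exists B : 'M[R]_(h * p, L), forall x : 'cV_L, B *m x = 0 ->
    norm2 ((Num.sqrt D%:R)^-1 *: mh_attention U WQ WK WV *m x)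
      <= eta * c * norm2 x.
Proof.
move=> c_ge0 UC.
have [B YB] := mh_attention_kernel dh_gt0 U_le1 WQK_le WV_le1 c_ge0 UC.
exists B => x Bx; rewrite -scalemxAl norm2Z gtr0_norm ?invr_gt0 //.
have -> : eta * c * norm2 x =
    (Num.sqrt D%:R)^-1 * (expR 1 ^+ 2 * h%:R * c * norm2 x).
  by rewrite /eta; ring.
by rewrite ler_pM2l ?invr_gt0 // YB.
Qed.

Lemma residual_singular_value1_ge : 2^-1 <= singular_value Z 1.
Proof.
(* With no forms at all and [c = 1], the kernel condition is empty and the attention term has norm
   at most [eta]. *)
have [|B YB] := @attention_term_kernel 0 0 1 ler01.
  by move=> x _; rewrite mul1r.
have eta_le : eta <= 2^-1.
  rewrite /eta ler_pdivrMr // ler_pdivlMl //; by rewrite mulrA.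
(* [U] is [Z] minus the attention term, and the assumption on [D] makes [eta] at most one half. *)
suff : singular_value U 1 <= singular_value Z 1 + eta by rewrite U_sv1; lra.
apply: (singular_value_le (B := (0 : 'M[R]_(0, L)))) => //.
  by rewrite addr_ge0 ?singular_value_ge0.
move=> x _; rewrite mulrDl.
have {1}-> : U = Z + - ((Num.sqrt D%:R)^-1 *: mh_attention U WQ WK WV).
  by rewrite /Z /residual_attention addrK.
rewrite mulmxDl; apply: le_trans (norm2D _ _) _.
apply: lerD; first exact: norm2_mulmx_le_singular_value1.
rewrite mulNmx -scaleN1r norm2Z normrN1 mul1r -[eta]mulr1; apply: YB.
by apply/matrixP => i; have := ltn_ord i; lia.
Qed.

Lemma residual_singular_value_le k j :
  (1 <= j <= k)%N -> (k <= h * dh)%N ->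
  singular_value Z k <=
    singular_value U (k - j + 1) + eta * singular_value U ((j - 1) %/ h + 1).
Proof.
move=> /andP[j_gt0 le_jk] le_kd.
have le_kL := leq_trans le_kd le_dL.
have le_divh : ((j - 1) %/ h <= j - 1)%N by apply: leq_div.
have [|B UB] := @singular_value_kernel _ _ _ U (k - j + 1); first by lia.
have [|C UC] := @singular_value_kernel _ _ _ U ((j - 1) %/ h + 1).
  by rewrite addn1 /= (leq_ltn_trans le_divh) //; lia.
have [E YE] := attention_term_kernel (singular_value_ge0 _ _) UC.
apply: (singular_value_le (B := col_mx B E)).
(* Form count: [k - j] for the residual branch plus [h * ((j - 1) %/ h) <= j - 1] for the heads,
   hence fewer than [k]. *)
- rewrite !addn1 /= le_kL andbT.
  by move: (leq_trunc_div (j - 1) h); rewrite mulnC; move: (h * _)%N => q; lia.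
- by rewrite addr_ge0 ?mulr_ge0 ?singular_value_ge0.
move=> x; rewrite mul_col_mx -col_mx0 => /eq_col_mx[Bx Ex].
rewrite /Z /residual_attention mulmxDl mulrDl.
by apply: le_trans (norm2D _ _) _; rewrite lerD ?UB ?YE.
Qed.

(** The factor [2] is the price of dividing by a top singular value known only to be at least one
    half. *)
Lemma residual_ratio_le k j :
  (1 <= j <= k)%N -> (k <= h * dh)%N ->
  singular_value Z k / singular_value Z 1 <=
    2 * (singular_value U (k - j + 1)
         + eta * singular_value U ((j - 1) %/ h + 1)).
Proof.
move=> jk kd; have s1_ge := residual_singular_value1_ge.
have s1_gt0 : 0 < singular_value Z 1.
  by apply: lt_le_trans s1_ge; rewrite invr_gt0.
rewrite ler_pdivrMr //; apply: le_trans (residual_singular_value_le jk kd) _.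
rewrite [leRHS]mulrAC ler_peMl //; last by lra.
by rewrite addr_ge0 ?mulr_ge0 ?singular_value_ge0.
Qed.

End UpperBound.

(** * Extremal example *)

Lemma sum_ord_pick (V : nmodType) n (F : nat -> V) b :
  \sum_(t < n) F t *+ (t == b :> nat) = F b *+ (b < n)%N.
Proof.
have [lt_bn|le_nb] := ltnP b n.
  rewrite (bigD1 (Ordinal lt_bn)) //= eqxx big1 ?addr0 // => t.
  by rewrite -val_eqE /= => /negPf ->.
rewrite big1 // => t _; case: eqP => // tb.
by have := ltn_ord t; lia.
Qed.

Definition rdiag_mx (V : nmodType) m n (w : nat -> V) : 'M[V]_(m, n) :=
  \matrix_(i, j) (w i *+ (i == j :> nat)).

Section RectangularDiagonal.
Variables (R : realType) (m n : nat).
Hypothesis le_mn : (m <= n)%N.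
Implicit Types (w : nat -> R) (x : 'cV[R]_n).

Lemma sqr_norm2_rdiag w x :
  norm2 (rdiag_mx m n w *m x) ^+ 2
    = \sum_(j < n | (j < m)%N) w j ^+ 2 * x j 0 ^+ 2.
Proof.
rewrite sqr_norm2 (big_ord_narrow le_mn); apply: eq_bigr => i _ /=.
rewrite -exprMn mxE (bigD1 (widen_ord le_mn i)) //= big1 => [|j].
  by rewrite mxE eqxx addr0.
by rewrite -val_eqE /= mxE eq_sym => /negPf ->; rewrite mul0r.
Qed.

Lemma norm2_rdiag_le w x c :
  0 <= c ->
  (forall j : 'I_n, (j < m)%N -> x j 0 != 0 -> `|w j| <= c) ->
  norm2 (rdiag_mx m n w *m x) <= c * norm2 x.
Proof.
move=> c_ge0 wc; rewrite -ler_sqr ?nnegrE ?mulr_ge0 ?norm2_ge0 // exprMn.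
rewrite sqr_norm2_rdiag sqr_norm2 mulr_sumr big_mkcond; apply: ler_sum => j _.
case: ifP => [lt_jm|_]; last by rewrite mulr_ge0 ?sqr_ge0.
have [->|xj_neq0] := eqVneq (x j 0) 0; first by rewrite expr0n !mulr0.
rewrite ler_wpM2r ?sqr_ge0 // -[w j ^+ 2]real_normK ?num_real //.
by rewrite ler_sqr ?nnegrE ?wc.
Qed.

Lemma norm2_rdiag_ge w x c :
  0 <= c ->
  (forall j : 'I_n, x j 0 != 0 -> (j < m)%N /\ c <= w j) ->
  c * norm2 x <= norm2 (rdiag_mx m n w *m x).
Proof.
move=> c_ge0 cw; rewrite -ler_sqr ?nnegrE ?mulr_ge0 ?norm2_ge0 // exprMn.
rewrite sqr_norm2_rdiag sqr_norm2 mulr_sumr [leRHS]big_mkcond.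
apply: ler_sum => j _.
have [->|xj_neq0] := eqVneq (x j 0) 0.
  by rewrite expr0n !mulr0; case: ifP.
have [-> c_le] := cw j xj_neq0.
by rewrite ler_wpM2r ?sqr_ge0 // ler_sqr ?nnegrE // (le_trans c_ge0).
Qed.

(** The first [k.-1] coordinates serve as linear forms for the upper bound, and the first [k]
    coordinates span the test space for the lower bound. *)
Lemma singular_value_rdiag w k :
  (0 < k <= m)%N ->
  (forall i, (i < m)%N -> 0 <= w i) ->
  (forall i j, (i <= j < m)%N -> w j <= w i) ->
  singular_value (rdiag_mx m n w) k = w k.-1.
Proof.
case: k => // k lt_km w_ge0 w_anti.
have lt_kn : (k < n)%N := leq_trans lt_km le_mn.
apply/le_anti/andP; split.
  apply: (singular_value_le (B := rowsub (widen_ord (ltnW lt_kn)) 1%:M)).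
  - by rewrite leqnn.
  - exact: w_ge0.
  move=> x; rewrite mul_rowsub_mx mul1mx => x0; apply: norm2_rdiag_le.
    exact: w_ge0.
  move=> j lt_jm xj_neq0; rewrite ger0_norm ?w_ge0 // w_anti // lt_jm andbT.
  rewrite leqNgt; apply: contra xj_neq0 => lt_jk.
  move/colP/(_ (Ordinal lt_jk)): x0; rewrite !mxE => <-; apply/eqP.
  by congr (x _ 0); apply: val_inj.
apply: (singular_value_ge (J := [set i : 'I_n | (i < k.+1)%N])).
  by rewrite card_ord_lt //= leqnn.
move=> x xJ; apply: norm2_rdiag_ge => [|j]; first exact: w_ge0.
move=> xj_neq0; have : j \in [set i : 'I_n | (i < k.+1)%N].
  by apply: contraNT xj_neq0 => /xJ ->.
rewrite inE ltnS => le_jk; split; first exact: leq_ltn_trans le_jk lt_km.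
by apply: w_anti; rewrite le_jk.
Qed.

End RectangularDiagonal.

(** This ensures that a box of [i] heads by [ceil_div k i] offsets supplies at least [k]
    coordinates. *)
Lemma leq_mul_ceil_div k i : (0 < i)%N -> (k <= i * ceil_div k i)%N.
Proof.
move=> i_gt0; rewrite /ceil_div.
have := divn_eq (k + i.-1) i; have := ltn_pmod (k + i.-1) i_gt0.
rewrite [(i * _)%N]mulnC; move: (_ %/ i * i)%N (_ %% i)%N => q r; lia.
Qed.

(** * Sharply peaked attention on a diagonal input *)

Section LowerBound.
Variables (R : realType) (h dh L D : nat) (sigma : nat -> R) (K : R).
Hypothesis h_gt0 : (0 < h)%N.
Hypothesis dh_gt0 : (0 < dh)%N.
Hypothesis D_gt0 : (0 < D)%N.
Hypothesis le_dL : (h * dh <= L)%N.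
Hypothesis sigma_gt0 : forall k, (0 < k <= h * dh)%N -> 0 < sigma k.
Hypothesis K_gt0 : 0 < K.

Let s : R := (Num.sqrt D%:R)^-1.
(** Inverse softmax denominator of a column with one logit [ln K] and [L.-1] zero logits. *)
Let delta : R := (K + L.-1%:R)^-1.

Definition sharp_input : 'M[R]_(h * dh, L) :=
  rdiag_mx _ _ (fun a => sigma a.+1).

(* Token [head_target i j] gets the attention of token [j] in head [i]; the
   sink [dh.-1] is erased by [sharp_value]. *)
Definition head_target (i j : nat) : nat :=
  if (j %/ dh == i)%N && (j %% dh < dh.-1)%N then (j %% dh)%N else dh.-1.

(** Dividing by [sigma] undoes the diagonal input, and [Num.sqrt dh%:R] cancels the attention
    scaling, so that a matched pair has logit exactly [ln K]. All heads share the same query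
    block. *)
Definition sharp_query : 'M[R]_(h * dh) :=
  \matrix_(a, t)
    (ln K * Num.sqrt dh%:R / sigma t.+1 *+ (t == a %% dh :> nat)%N).

Definition sharp_key : 'M[R]_(h * dh) :=
  \matrix_(a, t) ((sigma t.+1)^-1 *+ (head_target (a %/ dh) t == a %% dh)%N).

Definition sharp_value : 'M[R]_(h * dh) :=
  \matrix_(a, t) ((a %% dh < dh.-1)%N%:R *+ (t == a %% dh :> nat)%N).

(** What row [a] of the scaled attention term would carry if its weight were [1]; it is zero on the
    sink row of each head. *)
Let gain (a : nat) : R := (a %% dh < dh.-1)%N%:R * (s * sigma (a %% dh).+1).

(** Past the first [h * dh] columns the input is zero, so all logits vanish and the weights are
    uniform. *)
Definition sharp_leak : 'M[R]_(h * dh, L) :=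
  \matrix_(a, j) (gain a * (if (j < h * dh)%N then delta else L%:R^-1)).

(** The weight [K * delta] of a diagonal position splits into [delta], kept in [sharp_leak], and
    [(K - 1) * delta = 1 - L * delta]. *)
Definition sharp_diag (a : nat) : R :=
  sigma a.+1 + gain a * (1 - L%:R * delta).

Lemma head_target_lt i j : (head_target i j < dh)%N.
Proof. by rewrite /head_target; case: ifP; lia. Qed.

Let mod_lt_d a : (a %% dh < h * dh)%N.
Proof.
apply: (@leq_trans dh); first by rewrite ltn_mod.
by rewrite leq_pmull.
Qed.

Lemma query_input (i : 'I_h) r (t : 'I_L) :
  (row_block sharp_query i *m sharp_input) r t
    = ln K * Num.sqrt dh%:R *+ (r == t :> nat).
Proof.
rewrite mxE; transitivity (\sum_(u < h * dh)
    (ln K * Num.sqrt dh%:R / sigma u.+1 * (sigma u.+1 *+ (u == t :> nat)))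
      *+ (u == r :> nat)).
  apply: eq_bigr => u _; rewrite !mxE /= modnMDl modn_small //.
  by rewrite mulrnAl.
have lt_rd : (r < h * dh)%N by rewrite -(modn_small (ltn_ord r)).
rewrite (sum_ord_pick _ (fun u => ln K * Num.sqrt dh%:R / sigma u.+1
    * (sigma u.+1 *+ (u == t :> nat)))) lt_rd mulr1n mulrnAr divfK //.
by rewrite gt_eqF ?sigma_gt0.
Qed.

Lemma key_input (i : 'I_h) r (j : 'I_L) :
  (row_block sharp_key i *m sharp_input) r j
    = ((j < h * dh)%N && (head_target i j == r))%:R.
Proof.
rewrite mxE; transitivity (\sum_(u < h * dh)
    ((sigma u.+1)^-1 * sigma u.+1 *+ (head_target i u == r))
      *+ (u == j :> nat)).
  apply: eq_bigr => u _; rewrite !mxE /= modnMDl modn_small //.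
  by rewrite divnMDl // divn_small // addn0 mulrnAr mulrnAl.
rewrite (sum_ord_pick _ (fun u => (sigma u.+1)^-1 * sigma u.+1
    *+ (head_target i u == r))).
have [lt_jd|] := ltnP j (h * dh); last by rewrite mulr0n.
by rewrite mulr1n mulVf // gt_eqF ?sigma_gt0.
Qed.

Lemma value_input (i : 'I_h) r (t : 'I_L) :
  (row_block sharp_value i *m sharp_input) r t
    = (r < dh.-1)%N%:R * sigma r.+1 *+ (t == r :> nat).
Proof.
rewrite mxE; transitivity (\sum_(u < h * dh)
    ((r < dh.-1)%N%:R * (sigma u.+1 *+ (u == t :> nat))) *+ (u == r :> nat)).
  apply: eq_bigr => u _; rewrite !mxE /= modnMDl modn_small //.
  by rewrite mulrnAl.
have lt_rd : (r < h * dh)%N by rewrite -(modn_small (ltn_ord r)).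
rewrite (sum_ord_pick _ (fun u => (r < dh.-1)%N%:R
                                  * (sigma u.+1 *+ (u == t :> nat)))).
by rewrite lt_rd mulr1n mulrnAr eq_sym.
Qed.

Let logits (i : 'I_h) := (Num.sqrt dh%:R)^-1 *:
  (sharp_input^T *m (row_block sharp_query i)^T *m row_block sharp_key i
   *m sharp_input).

Lemma sharp_logitsE i t j :
  logits i t j = ln K *+ ((j < h * dh)%N && (head_target i j == t)).
Proof.
rewrite /logits -trmx_mul -mulmxA mxE.
have -> : ((row_block sharp_query i *m sharp_input)^T
    *m (row_block sharp_key i *m sharp_input)) t j =
    \sum_(r < dh) (ln K * Num.sqrt dh%:R
       *+ ((j < h * dh)%N && (head_target i j == r))) *+ (r == t :> nat).
  rewrite mxE; apply: eq_bigr => r _.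
  by rewrite mxE query_input key_input mulr_natr -!mulrnA mulnC.
rewrite (sum_ord_pick _ (fun r => ln K * Num.sqrt dh%:R
       *+ ((j < h * dh)%N && (head_target i j == r)))).
case: eqP => [<-|_]; last by rewrite andbF !mulr0n mul0rn mulr0.
rewrite head_target_lt mulr1n andbT; case: (j < _)%N; last by rewrite mulr0.
by rewrite !mulr1n mulrC mulfK // gt_eqF // sqrtr_gt0 ltr0n.
Qed.

Let attention_weight (i j t : nat) : R :=
  if (j < h * dh)%N then (if head_target i j == t then K else 1) * delta
  else L%:R^-1.

Let L_gt0 : (0 < L)%N.
Proof. by apply: leq_trans le_dL; rewrite muln_gt0 h_gt0. Qed.

Lemma sharp_softmaxE i t j :
  softmax (logits i) t j = attention_weight i j t.
Proof.
(* Writing the exponential as [1] plus a multiple of an indicator makes the denominator a constant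
   sum plus a single picked term. *)
have expE (u : 'I_L) : expR (logits i u j) =
    1 + (K - 1) *+ ((j < h * dh)%N && (head_target i j == u)).
  rewrite sharp_logitsE; case: (_ && _); last by rewrite !mulr0n expR0 addr0.
  by rewrite !mulr1n lnK ?posrE // addrC subrK.
rewrite mxE expE /attention_weight.
under eq_bigr do rewrite expE.
have [lt_jd|le_dj] := ltnP j (h * dh); last first.
  by rewrite /= addr0 mul1r sumr_const card_ord.
rewrite /=; congr (_ * _).
  by case: eqP => _; rewrite ?mulr1n ?mulr0n ?addr0 // addrC subrK.
rewrite big_split /= sumr_const card_ord.
under eq_bigr do rewrite eq_sym.
rewrite (sum_ord_pick _ (fun=> K - 1)).
have -> : (head_target i j < L)%N.
  apply: leq_trans (head_target_lt _ _) (leq_trans _ le_dL).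
  by rewrite leq_pmull.
rewrite mulr1n /delta -[in LHS](prednK L_gt0) mulrS; congr (_^-1).
by ring.
Qed.

Lemma sharp_headE (i : 'I_h) r j :
  (row_block sharp_value i *m sharp_input *m softmax (logits i)) r j
    = (r < dh.-1)%N%:R * sigma r.+1 * attention_weight i j r.
Proof.
rewrite mxE; transitivity (\sum_(t < L)
    ((r < dh.-1)%N%:R * sigma r.+1 * attention_weight i j t)
      *+ (t == r :> nat)).
  by apply: eq_bigr => t _; rewrite value_input sharp_softmaxE mulrnAl.
rewrite (sum_ord_pick _ (fun t => (r < dh.-1)%N%:R * sigma r.+1
                                  * attention_weight i j t)).
have -> : (r < L)%N.
  apply: leq_trans (ltn_ord r) (leq_trans _ le_dL); by rewrite leq_pmull.
by rewrite mulr1n.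
Qed.

(** This makes the peaked part diagonal: outside the sink row, row [a] is the target of column [a]
    alone, since columns of other blocks go to the sink. *)
Lemma head_target_eq a j : (a %% dh < dh.-1)%N ->
  (head_target (a %/ dh) j == a %% dh)%N = (a == j).
Proof.
move=> lt_a; rewrite /head_target; case: ifPn => [/andP[/eqP ja lt_j]|].
  apply/eqP/eqP => [ja'|->//].
  by rewrite (divn_eq a dh) -ja -ja' -divn_eq.
rewrite negb_and => cond; rewrite gtn_eqF //; apply/esym/negbTE.
by apply: contraL cond => /eqP <-; rewrite eqxx lt_a.
Qed.

Lemma residual_sharpE :
  residual_attention D sharp_input sharp_query sharp_key sharp_value
    = rdiag_mx _ _ sharp_diag + sharp_leak.
Proof.
apply/matrixP => a j; rewrite /residual_attention /sharp_input.
have -> : mh_attention sharp_input sharp_query sharp_key sharp_value =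
    \matrix_(a, j) ((a %% dh < dh.-1)%N%:R * sigma (a %% dh).+1
                    * attention_weight (a %/ dh) j (a %% dh)).
  by apply/matrixP => a' j'; rewrite [LHS]mxE sharp_headE mxE.
rewrite !mxE /sharp_diag /attention_weight /gain.
have [lt_a|ge_a] := ltnP (a %% dh) dh.-1; last by rewrite !mul0r !mulr0 !addr0.
rewrite !mul1r head_target_eq //.
(* A padding column never meets the diagonal, so only the uniform leak remains there. *)
have [lt_jd|le_dj] := ltnP j (h * dh); last first.
  have /negPf -> : (a : nat) != j.
    by apply: contraTneq le_dj => <-; rewrite -ltnNge.
  by rewrite !mulr0n !add0r mulrA.
have deltaK : (K + L.-1%:R) * delta = 1.
  by rewrite /delta divff // gt_eqF // ltr_wpDr.
have LE : L%:R = 1 + L.-1%:R :> R by rewrite -[in LHS](prednK L_gt0) mulrS.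
case: eqP => _; last by rewrite !mulr0n !add0r mul1r mulrA.
rewrite !mulr1n LE.
have -> : K * delta = 1 - L.-1%:R * delta.
  by apply/eqP; rewrite eq_sym subr_eq -mulrDl deltaK.
by rewrite /s; ring.
Qed.

Hypothesis sigma_le :
  forall i j, (0 < i <= j)%N -> (j <= h * dh)%N -> sigma j <= sigma i.
Hypothesis sigma1 : sigma 1 = 1.
Hypothesis K_large : 8 * L%:R / sigma (h * dh)%N <= K.

Let d_gt0 : (0 < h * dh)%N. Proof. by rewrite muln_gt0 h_gt0. Qed.

Let s_gt0 : 0 < s. Proof. by rewrite invr_gt0 sqrtr_gt0 ltr0n. Qed.

Let s_le1 : s <= 1.
Proof.
rewrite invf_le1 ?sqrtr_gt0 ?ltr0n // -[leLHS]sqrtr1.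
by rewrite ler_wsqrtr // ler1n.
Qed.

Let sigma_le1 k : (0 < k <= h * dh)%N -> sigma k <= 1.
Proof. by move=> /andP[k_gt0 le_kd]; rewrite -sigma1 sigma_le ?k_gt0. Qed.

Let LR_gt0 : 0 < L%:R :> R. Proof. by rewrite ltr0n. Qed.

Let delta_gt0 : 0 < delta.
Proof. by rewrite invr_gt0 ltr_wpDr. Qed.

(** Since [delta <= 1 / K], this is the lower bound on [K]. One eighth is chosen because the loss on
    the diagonal and the leak will each cost at most that fraction of the target value. *)
Let Ldelta_le : L%:R * delta <= sigma (h * dh)%N / 8.
Proof.
have sd_gt0 : 0 < sigma (h * dh)%N by rewrite sigma_gt0 // d_gt0 leqnn.
rewrite /delta ler_pdivrMr ?ltr_wpDr //.
apply: le_trans (_ : sigma (h * dh)%N / 8 * K <= _).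
  rewrite -ler_pdivrMl ?divr_gt0 // invf_div; apply: le_trans K_large.
  by rewrite mulrAC.
by rewrite ler_wpM2l ?lerDl // divr_ge0 // ltW.
Qed.

Let gain_ge0 a : 0 <= gain a.
Proof.
by rewrite !mulr_ge0 // ltW // sigma_gt0 //= mod_lt_d.
Qed.

Let gain_le1 a : gain a <= 1.
Proof.
rewrite /gain; case: ltnP => _; last by rewrite mul0r.
rewrite mul1r mulr_ile1 ?(ltW s_gt0) ?sigma_le1 //= ?mod_lt_d //.
by rewrite ltW // sigma_gt0 //= mod_lt_d.
Qed.

Lemma sharp_input_singular_value k :
  (0 < k <= h * dh)%N -> singular_value sharp_input k = sigma k.
Proof.
move=> /[dup] k_bd /andP[k_gt0 _].
rewrite singular_value_rdiag ?prednK // => [i lt_id|i j /andP[le_ij lt_jd]].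
  by rewrite ltW ?sigma_gt0.
by rewrite sigma_le.
Qed.

Lemma sharp_value_norm (i : 'I_h) :
  spectral_norm (row_block sharp_value i) <= 1.
Proof.
apply: spectral_norm_le => // x.
have -> : row_block sharp_value i =
    rdiag_mx dh (h * dh) (fun r => (r < dh.-1)%N%:R).
  by apply/matrixP => r t; rewrite !mxE /= modnMDl modn_small // eq_sym.
apply: norm2_rdiag_le => // [|j _ _]; first by rewrite leq_pmull.
by case: ltnP; rewrite ?normr1 ?normr0.
Qed.

Let Z := residual_attention D sharp_input sharp_query sharp_key sharp_value.

(** The diagonal entries are at most [1 + 1]. The leak has entries at most [1 / L] in an [h * dh] by
    [L] matrix, so its Frobenius norm is at most [1] because [h * dh <= L]. *)
Lemma sharp_singular_value1_le : singular_value Z 1 <= 3.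
Proof.
apply: (singular_value_le (B := (0 : 'M[R]_(0, L)))) => // x _.
rewrite /Z residual_sharpE mulmxDl; apply: le_trans (norm2D _ _) _.
have -> : 3 * norm2 x = 2 * norm2 x + 1 * norm2 x :> R by ring.
have Ldelta_le1 : L%:R * delta <= 1.
  apply: le_trans Ldelta_le _.
  have : sigma (h * dh)%N <= 1 by rewrite sigma_le1 // d_gt0 leqnn.
  lra.
have delta_le : delta <= L%:R^-1 by rewrite -[leRHS]mulr1 ler_pdivlMl.
apply: lerD.
  apply: norm2_rdiag_le => // j lt_jd _.
  have sj_gt0 : 0 < sigma j.+1 by rewrite sigma_gt0.
  have sj_le1 : sigma j.+1 <= 1 by rewrite sigma_le1.
  have t_ge0 : 0 <= 1 - L%:R * delta by lra.
  have t_le1 : 1 - L%:R * delta <= 1 by have := mulr_gt0 LR_gt0 delta_gt0; lra.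
  have gt_ge0 := mulr_ge0 (gain_ge0 j) t_ge0.
  have gt_le1 := mulr_ile1 (gain_ge0 j) t_ge0 (gain_le1 j) t_le1.
  by rewrite /sharp_diag ger0_norm; lra.
apply: norm2_mulmx_le => //.
apply: le_trans (_ : \sum_(i < h * dh) \sum_(j < L) (L%:R^-1) ^+ 2 <= _).
  apply: ler_sum => i _; apply: ler_sum => j _.
  rewrite mxE; set y : R := if _ then _ else _.
  have y_ge0 : 0 <= y.
    by rewrite /y; case: ifP; rewrite ?(ltW delta_gt0) ?invr_ge0.
  have y_le : y <= L%:R^-1 by rewrite /y; case: ifP.
  rewrite ler_sqr ?nnegrE ?invr_ge0 ?(mulr_ge0 (gain_ge0 i) y_ge0) //.
  by apply: le_trans y_le; rewrite ler_piMl ?gain_le1.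
rewrite !sumr_const !card_ord -mulrnA -[_ *+ (L * _)]mulr_natr natrM expr1n.
have -> : L%:R^-1 ^+ 2 * (L%:R * (h * dh)%:R) = (h * dh)%:R / L%:R :> R.
  by field; rewrite gt_eqF.
by rewrite ler_pdivrMr // mul1r ler_nat.
Qed.

(** The test space is spanned by the coordinates [p * dh + q] with [p < i] and [q < m], at least [k]
    in number. As [sigma] is nonincreasing, each diagonal entry there is at least [(1 - e) * lam],
    its worst case being the last offset of the last head used. *)
Lemma sharp_singular_value_ge k i :
  (0 < k)%N -> (0 < i <= h)%N -> (ceil_div k i < dh)%N ->
  3 / 4 * (sigma ((i - 1) * dh + ceil_div k i)%N + s * sigma (ceil_div k i))
    <= singular_value Z k.
Proof.
move=> k_gt0 /andP[i_gt0 le_ih]; set m := ceil_div k i => lt_m.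
have le_kim : (k <= i * m)%N := leq_mul_ceil_div k i_gt0.
clearbody m.
have m_gt0 : (0 < m)%N by move: le_kim; case: (m) => //; lia.
set lam := sigma _ + s * sigma m.
have pos_lt p q : (p < i)%N -> (q < m)%N -> (p * dh + q < h * dh)%N.
  move=> lt_pi lt_qm; apply: (@leq_trans (p.+1 * dh)).
    by rewrite mulSn addnC ltn_add2r (ltn_trans lt_qm).
  by rewrite leq_mul2r (leq_trans lt_pi) ?orbT.
have idx_le p q : (p < i)%N -> (q < m)%N -> (p * dh + q < (i - 1) * dh + m)%N.
  move=> lt_pi lt_qm; rewrite -addnS; apply: leq_add lt_qm.
  by rewrite leq_mul2r; apply/orP; right; lia.
have last_le : ((i - 1) * dh + m <= h * dh)%N.
  by have := pos_lt (i - 1)%N m.-1; rewrite -(ltn_predK m_gt0) /=; lia.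
pose f (u : 'I_i * 'I_m) : 'I_L :=
  widen_ord le_dL (Ordinal (pos_lt _ _ (ltn_ord u.1) (ltn_ord u.2))).
have f_inj : injective f.
  move=> [p q] [p' q'] /(congr1 val) /= eq_f.
  have lt_q (r : 'I_m) : (r < dh)%N := ltn_trans (ltn_ord r) lt_m.
  have /(congr1 (divn^~ dh)) := eq_f.
  rewrite !divnMDl // !divn_small // !addn0 => pp.
  have /(congr1 (modn^~ dh)) := eq_f; rewrite !modnMDl !modn_small // => qq.
  by congr (_, _); apply: val_inj.
have sd_le j : (0 < j <= h * dh)%N -> sigma (h * dh)%N <= sigma j.
  by move=> /andP[j_gt0 le_jd]; rewrite sigma_le ?j_gt0.
have sd_gt0 : 0 < sigma (h * dh)%N by rewrite sigma_gt0 // d_gt0 leqnn.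
have le_md : (m <= h * dh)%N := leq_trans (leq_addl _ _) last_le.
have sm_gt0 : 0 < s * sigma m by rewrite mulr_gt0 // sigma_gt0 ?m_gt0.
have idx_gt0 : (0 < (i - 1) * dh + m <= h * dh)%N.
  by rewrite last_le andbT addn_gt0 m_gt0 orbT.
have lam_ge : sigma (h * dh)%N <= lam.
  by rewrite /lam ler_wpDr ?(ltW sm_gt0) // sd_le.
have sd_le1 : sigma (h * dh)%N <= 1 by rewrite sigma_le1 // d_gt0 leqnn.
set e := L%:R * delta.
have e_gt0 : 0 < e by rewrite mulr_gt0.
have e_le : e <= sigma (h * dh)%N / 8 := Ldelta_le.
apply: (singular_value_ge (J := [set f u | u in [set: 'I_i * 'I_m]])).
  by rewrite card_imset // finset.cardsT card_prod !card_ord k_gt0.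
move=> x xJ.
have {}xJ j : x j 0 != 0 -> exists p q,
    [/\ (p < i)%N, (q < m)%N & j = (p * dh + q)%N :> nat].
  move=> xj_neq0; have : j \in [set f u | u in [set: 'I_i * 'I_m]].
    by apply: contraNT xj_neq0 => /xJ ->.
  by case/imsetP => -[p q] _ ->; exists p, q.
rewrite /Z residual_sharpE mulmxDl.
have diag_ge : (1 - e) * lam * norm2 x
    <= norm2 (rdiag_mx (h * dh) L sharp_diag *m x).
  apply: norm2_rdiag_ge => // [|j /xJ[p [q [lt_pi lt_qm jE]]]].
    by apply: mulr_ge0; lra.
  have lt_jd : (j < h * dh)%N by rewrite jE pos_lt.
  split=> //; rewrite /sharp_diag /gain.
  have -> : (j %% dh)%N = q.
    by rewrite jE modnMDl modn_small // (ltn_trans lt_qm).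
  (* The strict inequality [m < dh] keeps the test space away from the sink rows. *)
  have -> : (q < dh.-1)%N by rewrite ltn_predRL (leq_ltn_trans lt_qm lt_m).
  have sj : sigma ((i - 1) * dh + m)%N <= sigma j.+1.
    by rewrite sigma_le //= jE idx_le.
  have sq : s * sigma m <= s * sigma q.+1 by rewrite ler_pM2l // sigma_le.
  rewrite mul1r -/e mulrC /lam mulrDl; apply: lerD.
    apply: le_trans sj; rewrite ler_piMr; [by []| |lra].
    by rewrite ltW // sigma_gt0.
  by rewrite ler_wpM2r //; lra.
have leak_le : norm2 (sharp_leak *m x) <= e * norm2 x.
  (* The support of [x] avoids the padding columns, so the larger weight [1 / L] can be replaced by
     [delta] everywhere. *)
  have -> : sharp_leak *m x =
      (\matrix_(a < h * dh, j < L) (gain a * delta)) *m x.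
    apply/matrixP => a c; rewrite !mxE; apply: eq_bigr => j _.
    rewrite !mxE ord1.
    have [->|/xJ[p [q [lt_pi lt_qm jE]]]] := eqVneq (x j 0) 0.
      by rewrite !mulr0.
    by rewrite jE pos_lt.
  apply: norm2_mulmx_le; first exact: ltW.
  apply: le_trans (_ : \sum_(a < h * dh) \sum_(j < L) delta ^+ 2 <= _).
    apply: ler_sum => a _; apply: ler_sum => j _.
    have gd_ge0 := mulr_ge0 (gain_ge0 a) (ltW delta_gt0).
    by rewrite mxE ler_sqr ?nnegrE ?gd_ge0 ?(ltW delta_gt0) // ler_piMl // ltW.
  rewrite !sumr_const !card_ord -mulrnA -[_ *+ (L * _)]mulr_natr natrM exprMn.
  by rewrite mulrC ler_wpM2r ?sqr_ge0 // expr2 ler_wpM2l ?ler_nat //.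
(* Reverse triangle inequality: the diagonal part is the whole minus the leak. *)
have := norm2D (rdiag_mx (h * dh) L sharp_diag *m x + sharp_leak *m x)
               (- (sharp_leak *m x)).
rewrite addrK -scaleN1r norm2Z normrN1 mul1r.
suff : 3 / 4 * lam * norm2 x <= (1 - e) * lam * norm2 x - e * norm2 x by lra.
rewrite -mulrBl ler_wpM2r ?norm2_ge0 //.
(* Both [e * lam] and [e] are at most [lam / 8], the latter because [lam] is at least the smallest
   [sigma]; hence the constant [3 / 4]. *)
have el_le : e * lam <= 8^-1 * lam by rewrite ler_wpM2r //; lra.
by rewrite mulrBl mul1r; lra.
Qed.

End LowerBound.

(** * Assembly of the two bounds *)

Theorem theorem4 (R : realType) (h dh L D : nat) (sigma : nat -> R)
    (h_gt0 : (0 < h)%N) (dh_gt0 : (0 < dh)%N) (D_gt0 : (0 < D)%N)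
    (le_dL : (h * dh <= L)%N)
    (sigma1 : sigma 1%N = 1)
    (sigma_noninc : forall k : nat,
       (1 <= k < h * dh)%N -> sigma k.+1 <= sigma k)
    (sigma_gt0 : 0 < sigma (h * dh)%N) :
  (2 * expR 1 ^+ 2 * h%:R <= Num.sqrt (D%:R : R) ->
   forall (U : 'M[R]_(h * dh, L)) (WQ WK WV : 'M[R]_(h * dh)),
     (forall k : nat, (1 <= k <= h * dh)%N -> singular_value U k = sigma k) ->
     (forall i : 'I_h,
        spectral_norm ((row_block WQ i)^T *m row_block WK i)
          <= Num.sqrt (dh%:R : R)
        /\ spectral_norm (row_block WV i) <= 1) ->
     let Z := residual_attention D U WQ WK WV in
     forall k : nat, (1 <= k <= h * dh)%N ->
       let bound (j : nat) : R :=
         sigma (k - j + 1)%N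
         + expR 1 ^+ 2 * h%:R / Num.sqrt D%:R
           * sigma ((j - 1) %/ h + 1)%N in
       singular_value Z k / singular_value Z 1
         <= 2 * \big[Num.min/bound 1%N]_(1 <= j < k.+1) bound j)
  /\
  (exists (U : 'M[R]_(h * dh, L)) (WQ WK WV : 'M[R]_(h * dh)),
     (forall k : nat, (1 <= k <= h * dh)%N -> singular_value U k = sigma k) /\
     (forall i : 'I_h, spectral_norm (row_block WV i) <= 1) /\
     let Z := residual_attention D U WQ WK WV in
     forall k : nat, (1 <= k <= h * dh)%N ->
     forall i : nat, (1 <= i <= h)%N -> (ceil_div k i < dh)%N ->
       4^-1 * (sigma ((i - 1) * dh + ceil_div k i)%N
               + (Num.sqrt D%:R)^-1 * sigma (ceil_div k i))
         <= singular_value Z k / singular_value Z 1).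
Proof.
have d_gt0 : (0 < h * dh)%N by rewrite muln_gt0 h_gt0.
have sigma_le i j : (0 < i <= j)%N -> (j <= h * dh)%N -> sigma j <= sigma i.
  move=> /andP[i_gt0 /subnK <-]; elim: (j - i)%N => // n IHn.
  rewrite addSn => lt_d; apply: le_trans (IHn (ltnW lt_d)).
  by rewrite sigma_noninc // lt_d addn_gt0 i_gt0 orbT.
split=> [D_large U WQ WK WV U_sv W_le Z k /andP[k_gt0 le_kd]|].
  pose bound j : R := sigma (k - j + 1)%N
    + expR 1 ^+ 2 * h%:R / Num.sqrt D%:R * sigma ((j - 1) %/ h + 1)%N.
  have ratio_le j : (1 <= j <= k)%N ->
      singular_value Z k / singular_value Z 1 <= 2 * bound j.
    move=> /[dup] j_bd /andP[j_gt0 le_jk].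
    have le_div : (0 < (j - 1) %/ h + 1 <= h * dh)%N.
      rewrite addn1 /=; apply: leq_ltn_trans (leq_div _ _) _.
      by rewrite subn1 prednK // (leq_trans le_jk).
    have W_QK i := (W_le i).1; have W_V i := (W_le i).2.
    have le_kj : (0 < k - j + 1 <= h * dh)%N.
      rewrite addn1 /= -subSn // (leq_trans _ le_kd) //.
      by rewrite leq_subLR -add1n leq_add2r.
    rewrite /bound -(U_sv _ le_kj) -(U_sv _ le_div).
    apply: residual_ratio_le => //.
    by rewrite U_sv.
  change (singular_value Z k / singular_value Z 1
            <= 2 * \big[Num.min/bound 1%N]_(1 <= j < k.+1) bound j).
  rewrite -ler_pdivrMl // big_nat_cond.
  (* The default value [bound 1] of the minimum must be bounded too; [j = 1] is admissible because
     [k] is positive. *)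
  apply: le_bigmin => [|j /andP[j_bd _]]; rewrite ler_pdivrMl // ratio_le //.
have sigma_pos k : (0 < k <= h * dh)%N -> 0 < sigma k.
  by move=> k_bd; apply: lt_le_trans sigma_gt0 (sigma_le _ _ k_bd _).
have L_gt0 : (0 < L)%N := leq_trans d_gt0 le_dL.
pose K := 8 * L%:R / sigma (h * dh)%N.
have K_gt0 : 0 < K by rewrite divr_gt0 // mulr_gt0 // ltr0n.
exists (sharp_input h dh L sigma), (sharp_query h dh sigma K),
  (sharp_key h dh sigma), (sharp_value R h dh).
split; first by move=> k; apply: sharp_input_singular_value.
split; first by move=> i; apply: sharp_value_norm.
move=> Z k /andP[k_gt0 le_kd] i i_bd lt_dh.
have s1_le : singular_value Z 1 <= 3 by apply: sharp_singular_value1_le.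
have sk_ge := sharp_singular_value_ge h_gt0 dh_gt0 D_gt0 le_dL sigma_pos K_gt0
  sigma_le sigma1 (lexx K) k_gt0 i_bd lt_dh.
have m_gt0 : (0 < ceil_div k i)%N.
  have /andP[i_gt0 _] := i_bd.
  have := leq_trans k_gt0 (leq_mul_ceil_div k i_gt0).
  by rewrite muln_gt0 => /andP[].
have idx_le : ((i - 1) * dh + ceil_div k i <= h * dh)%N.
  have /andP[i_gt0 le_ih] := i_bd.
  apply: leq_trans (leq_mul le_ih (leqnn dh)).
  by rewrite subn1 -[in leqRHS](prednK i_gt0) mulSn addnC leq_add2r ltnW.
set lam := sigma _ + _ in sk_ge *.
have lam_gt0 : 0 < lam.
  rewrite addr_gt0 ?mulr_gt0 ?invr_gt0 ?sqrtr_gt0 ?ltr0n ?sigma_pos //.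
    by rewrite idx_le addn_gt0 m_gt0 orbT.
  by rewrite m_gt0 (leq_trans _ idx_le) ?leq_addl.
(* Positivity is needed to clear the quotient; it comes from the [k]-th singular value, which the
   first one dominates. *)
have s1_gt0 : 0 < singular_value Z 1.
  apply: (@lt_le_trans _ _ (3 / 4 * lam)); first by rewrite mulr_gt0.
  apply: le_trans sk_ge (singular_value_anti _ _ _) => //.
  by rewrite (leq_trans le_kd).
(* The constant [1 / 4] is [3 / 4] divided by the bound [3] on the top singular value. *)
rewrite ler_pdivlMr //; apply: le_trans sk_ge.
apply: le_trans (ler_wpM2l _ s1_le) _; first by rewrite mulr_ge0 // ltW.
by rewrite mulrAC [4^-1 * 3]mulrC.
Qed.
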